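(* Let $\phi$ be a formula in the language of $\mathbf{PD}$ whose propositional variables are among $p_{i_1},\dots,p_{i_n}$ (with $n\ge1$ and $i_1,\dots,i_n$ distinct), and let $N=\{i_1,\dots,i_n\}$. Then $\phi$ is semantically equivalent to a formula in conjunctive normal form $$\bigwedge_{g\in G}\bigl(\alpha_{k_g}\otimes\Theta_{2^N\setminus Y_g}\bigr),$$ where $G$ is a finite set of indices and each $Y_g$ is a nonempty team on $N$ with $|Y_g|=k_g+1$.
   Context: Propositional variables are $p_i$, $i\in\mathbb{N}$. A valuation is a function $s:\mathbb{N}\to\{0,1\}$; a team is a set of valuations. For finite $N\subseteq\mathbb{N}$, $2^N$ is the set of all functions $N\to\{0,1\}$ and a team on $N$ is a subset of $2^N$. Formulas of $\mathbf{PD}$ (propositional dependence logic) are given by $$\phi::=p_i\mid\neg p_i\mid\bot\mid\mathop{=}(p_{i_1},\dots,p_{i_k},p_j)\mid(\phi\wedge\phi)\mid(\phi\otimes\phi),$$ where $k\ge 0$ (for $k=0$ the dependence atom is $\mathop{=}(p_j)$). Truth on a team $X$: - $X\models p_i$ iff $s(i)=1$ for all $s\in X$; $X\models\neg p_i$ iff $s(i)=0$ for all $s\in X$; $X\models\bot$ iff $X=\emptyset$; - $X\models\mathop{=}(p_{i_1},\dots,p_{i_k},p_j)$ iff for all $s,s'\in X$, if $s(i_1)=s'(i_1),\dots,s(i_k)=s'(i_k)$ then $s(j)=s'(j)$; - $X\models\phi\wedge\psi$ iff $X\models\phi$ and $X\models\psi$; - $X\models\phi\otimes\psi$ iff there are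 $Y,Z\subseteq X$ with $X=Y\cup Z$, $Y\models\phi$ and $Z\models\psi$. Formulas are semantically equivalent if they are true on the same teams. Write $p_i^1:=p_i$, $p_i^0:=\neg p_i$. For a team $X$ on $N=\{i_1,\dots,i_n\}$, $$\Theta_X:=\bigotimes_{s\in X}(p_{i_1}^{s(i_1)}\wedge\dots\wedge p_{i_n}^{s(i_n)}),\qquad \Theta_\emptyset:=\bot.$$ Also $\alpha_0:=\bot$, $\alpha_1:=\mathop{=}(p_{i_1})\wedge\dots\wedge\mathop{=}(p_{i_n})$, and for $m\ge2$, $\alpha_m:=\bigotimes_{i=1}^m\alpha_1$ (the $\otimes$ of $m$ copies of $\alpha_1$). The empty conjunction ($G=\emptyset$) is understood as true on every team. *)

(* Defs.v *)
From mathcomp Require Import all_boot.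
From mathcomp Require Import boolp classical_sets.

Set Implicit Arguments.
Unset Strict Implicit.
Unset Printing Implicit Defensive.

Local Open Scope classical_set_scope.

Definition valuation := nat -> bool.
Definition team := set valuation.

(* Dep [:: i_1; ..; i_k] j is =(p_{i_1}, .., p_{i_k}, p_j); Dep [::] j is the
   constancy atom =(p_j). *)
Inductive form : Type :=
| Var of nat
| NVar of nat
| Bot
| Dep of seq nat & nat
| And of form & form
| Tensor of form & form.

Fixpoint vars (phi : form) : seq nat :=
  match phi with
  | Var i | NVar i => [:: i]
  | Bot => [::]
  | Dep s j => rcons s j
  | And phi1 phi2 | Tensor phi1 phi2 => vars phi1 ++ vars phi2
  end.

Fixpoint sat (X : team) (phi : form) : Prop :=
  match phi with
  | Var i => forall s, X s -> s i = true
  | NVar i => forall s, X s -> s i = false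
  | Bot => X = set0
  | Dep is_ j => forall s s', X s -> X s' ->
      (forall i, i \in is_ -> s i = s' i) -> s j = s' j
  | And phi1 phi2 => sat X phi1 /\ sat X phi2
  | Tensor phi1 phi2 => exists Y Z : team,
      [/\ Y `<=` X, Z `<=` X, X = Y `|` Z, sat Y phi1 & sat Z phi2]
  end.

(* op x_1 (op x_2 (.. x_n)), with no neutral element appended; x0 is the value
   on the empty sequence only. *)
Fixpoint foldr1 (op : form -> form -> form) (x0 : form) (s : seq form) : form :=
  match s with
  | [::] => x0
  | [:: x] => x
  | x :: s' => op x (foldr1 op x0 s')
  end.

Definition bigTensor (fs : seq form) : form := foldr1 Tensor Bot fs.

(* The language has no constant for truth, so the empty conjunction is kept
   outside [form], as None. *)
Definition bigAnd (fs : seq form) : option form :=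
  if fs is [::] then None else Some (foldr1 And Bot fs).

Definition osat (X : team) (phi : option form) : Prop :=
  if phi is Some psi then sat X psi else True.

Definition sem_equiv (phi psi : option form) : Prop :=
  forall X : team, osat X phi <-> osat X psi.

(* A finite nonempty set N of indices is given by a duplicate-free sequence
   listing i_1, .., i_n, and 2^N is the type of functions on its elements. In
   Theta and alpha1, the value Bot of the empty conjunction is junk, reached
   only when N is empty. *)
Notation pow2 N := {ffun seq_sub N -> bool}.

Definition lit (i : nat) (b : bool) : form := if b then Var i else NVar i.

Definition Theta (N : seq nat) (X : {set pow2 N}) : form :=
  bigTensor
    [seq foldr1 And Bot [seq lit (val i) (s i) | i : seq_sub N] | s : pow2 N in X].

Definition alpha1 (N : seq nat) : form :=
  foldr1 And Bot [seq Dep [::] i | i <- N].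

(* iterop m op x x0 is x0 if m = 0, and op x (.. (op x x)) with m copies of x
   otherwise. *)
Definition alpha (N : seq nat) (m : nat) : form :=
  iterop m Tensor (alpha1 N) Bot.

(* Main.v *)
Require Import Defs.
From mathcomp Require Import boolp classical_sets.
From mathcomp Require Import all_boot.

Set Implicit Arguments.
Unset Strict Implicit.
Unset Printing Implicit Defensive.

(** Truth of [phi] on a team depends only on the trace of the team on [N], and it
    is preserved when the trace shrinks.  A team satisfies
    [alpha_k (x) Theta_(2^N \ Y)], with [|Y| = k + 1], iff its trace does not
    contain [Y]: [alpha_k] bounds the size of a trace by [k], and [Theta_Z] says
    that the trace lies in [Z].  Hence [phi] is the conjunction of these formulas
    over all the teams [Y] on [N] that falsify [phi]; such a [Y] is nonempty since
    the empty team satisfies every formula. *)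

Lemma sat_foldr1_And (T : eqType) (F : T -> form) (s : seq T) (X : team) :
  s != [::] ->
  sat X (foldr1 And Bot (map F s)) <-> (forall x, x \in s -> sat X (F x)).
Proof.
elim: s => [//|x [|y s] IHs] _.
  by split=> [/= satx z|]; [rewrite inE => /eqP-> | apply; rewrite inE].
have {}IHs := IHs isT.
split=> [[satx sats] z|sat_all].
  by rewrite inE => /orP[/eqP-> //|]; apply: (proj1 IHs sats).
split; first by apply: sat_all; rewrite inE eqxx.
by apply: (proj2 IHs) => z zs; apply: sat_all; rewrite inE zs orbT.
Qed.

Lemma osat_bigAnd (T : eqType) (F : T -> form) (s : seq T) (X : team) :
  osat X (bigAnd (map F s)) <-> (forall x, x \in s -> sat X (F x)).
Proof. by case: s => [|x s] //; apply: (sat_foldr1_And F (s := x :: s)). Qed.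

(** When every disjunct is flat, i.e. tested one valuation at a time, a team can be split valuation
    by valuation, so the tensor acts as a classical disjunction. *)
Lemma sat_bigTensor_flat (T : eqType) (F : T -> form)
    (P : T -> valuation -> Prop) (s : seq T) :
  (forall x X, x \in s -> sat X (F x) <-> (forall v, X v -> P x v)) ->
  forall X, sat X (bigTensor (map F s)) <->
    (forall v, X v -> exists2 x, x \in s & P x v).
Proof.
elim: s => [_ X|x [|y s] IHs flatF X].
- split=> [/= -> //|no]; apply/seteqP; split=> v // /no[x].
  by rewrite in_nil.
- apply: (iff_trans (flatF x X (mem_head _ _))).
  split=> allP v /allP; first by exists x; rewrite ?mem_head.
  by case=> z; rewrite inE => /eqP->.
have {}IHs := IHs (fun z Z zs => flatF z Z (@mem_behead _ (x :: _) z zs)).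
have flatx Z := flatF x Z (mem_head _ _).
split=> [[Y [Z [_ _ -> satY satZ]]] v [Yv|Zv]|allP].
- by exists x; [exact: mem_head | exact: (proj1 (flatx Y) satY)].
- have [z zs Pzv] := proj1 (IHs Z) satZ v Zv.
  by exists z => //; rewrite inE zs orbT.
(* The two pieces may overlap: a tensor asks for a cover, not a partition. *)
exists (fun v => X v /\ P x v).
exists (fun v => X v /\ exists2 z, z \in y :: s & P z v).
split; [by move=> v [] | by move=> v [] | | | ].
- apply/seteqP; split=> [v Xv|v [[]|[]] //].
  have [z zs Pzv] := allP v Xv.
  move: zs Pzv; rewrite in_cons => /orP[/eqP-> Pxv|zs Pzv]; first by left.
  by right; split=> //; exists z.
- by apply: (proj2 (flatx _)) => v [].
- by apply: (proj2 (IHs _)) => v [].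
Qed.

Lemma sat_set0 (phi : form) : sat classical_sets.set0 phi.
Proof.
elim: phi => //= phi1 sat1 phi2 sat2.
exists classical_sets.set0, classical_sets.set0; split=> //.
by rewrite classical_sets.set0U.
Qed.

Lemma subset_cat_inv (T : eqType) (s1 s2 s : seq T) :
  {subset s1 ++ s2 <= s} -> {subset s1 <= s} /\ {subset s2 <= s}.
Proof.
by move=> sub; split=> x xs; apply: sub; rewrite mem_cat xs ?orbT.
Qed.

(* Locality and downward closure at once. *)
Lemma sat_agree (phi : form) (N : seq nat) (X Y : team) :
    {subset vars phi <= N} ->
    (forall s, Y s -> exists2 s', X s' & {in N, s =1 s'}) ->
  sat X phi -> sat Y phi.
Proof.
elim: phi X Y => [i|i||r j|phi1 IH1 phi2 IH2|phi1 IH1 phi2 IH2] X Y phiN YX /=.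
- by move=> Xi s /YX[s' /Xi <-]; apply; rewrite phiN ?mem_head.
- by move=> Xi s /YX[s' /Xi <-]; apply; rewrite phiN ?mem_head.
- by move=> X0; apply/seteqP; split=> s // /YX[s']; rewrite X0.
- move=> Xdep s t /YX[s' Xs' ss'] /YX[t' Xt' tt'] eq_st.
  have jN : j \in N by rewrite phiN // mem_rcons mem_head.
  rewrite ss' // tt' //; apply: Xdep => // i ir.
  have iN : i \in N by rewrite phiN // mem_rcons inE ir orbT.
  by rewrite -ss' // -tt' // eq_st.
- have [phi1N phi2N] := subset_cat_inv phiN.
  by move=> [/(IH1 _ _ phi1N YX) ? /(IH2 _ _ phi2N YX)].
have [phi1N phi2N] := subset_cat_inv phiN.
move=> [A [B [_ _ defX satA satB]]].
(* The splitting of [X] is pulled back to [Y]: a valuation goes to each side where it has a partner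
   agreeing with it on [N]. *)
pose from Z := (fun s => Y s /\ exists2 s', Z s' & {in N, s =1 s'}) : team.
exists (from A), (from B); split; [by move=> s [] | by move=> s [] | | | ].
- apply/seteqP; split=> [s Ys|s [[]|[]] //].
  have [s'] := YX s Ys; rewrite defX => -[As'|Bs'] ss'; [left|right];
    by split=> //; exists s'.
- by apply: IH1 satA => // s [].
- by apply: IH2 satB => // s [].
Qed.

Section Trace.

Variable N : seq nat.

Definition restr (s : valuation) : pow2 N := [ffun i => s (val i)].

Definition trace (X : team) : {set pow2 N} :=
  [set f | `[< exists2 s, X s & restr s = f >]].

(** The largest team with trace [Y]; it lets [sat] be evaluated at a team on [N]. *)
Definition cylinder (Y : {set pow2 N}) : team := fun s => restr s \in Y.

Lemma restr_eqP (s t : valuation) : restr s = restr t <-> {in N, s =1 t}.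
Proof.
split=> [eq_st i iN|eq_st].
  by move/ffunP/(_ (SeqSub iN)): eq_st; rewrite !ffunE.
by apply/ffunP=> i; rewrite !ffunE; apply: eq_st; exact: valP.
Qed.

Lemma restr_surj (f : pow2 N) : exists s, restr s = f.
Proof.
exists (fun i => if insub i is Some j then f j else false).
by apply/ffunP=> i; rewrite ffunE valK.
Qed.

Lemma traceP (X : team) (f : pow2 N) :
  reflect (exists2 s, X s & restr s = f) (f \in trace X).
Proof. by rewrite inE; apply: asboolP. Qed.

Lemma mem_trace (X : team) s : X s -> restr s \in trace X.
Proof. by move=> Xs; apply/traceP; exists s. Qed.

Lemma trace_subP (X : team) (Z : {set pow2 N}) :
  (trace X \subset Z) <-> (forall s, X s -> restr s \in Z).
Proof.
split=> [/subsetP XZ s Xs|XZ]; first by rewrite XZ ?mem_trace.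
by apply/subsetP=> f /traceP[s Xs <-]; apply: XZ.
Qed.

Lemma trace_setU (X Y : team) : trace (X `|` Y)%classic = trace X :|: trace Y.
Proof.
apply/setP=> f; rewrite in_setU; apply/traceP/orP.
  by case=> s [Xs|Ys] <-; [left|right]; apply: mem_trace.
by case=> /traceP[s ? <-]; exists s => //; [left|right].
Qed.

Lemma trace_cylinder (Y : {set pow2 N}) : trace (cylinder Y) = Y.
Proof.
apply/setP=> f; apply/traceP/idP => [[s Ys <-] //|Yf].
by have [s defs] := restr_surj f; exists s; rewrite /cylinder ?defs.
Qed.

Lemma sat_trace (phi : form) (X Y : team) :
  {subset vars phi <= N} -> trace Y \subset trace X -> sat X phi -> sat Y phi.
Proof.
move=> phiN /trace_subP YX; apply: (sat_agree phiN) => s.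
move=> /YX/traceP[s' Xs' eq_s]; exists s' => //.
by apply/restr_eqP; rewrite eq_s.
Qed.

Lemma sat_lit (X : team) i b : sat X (lit i b) <-> (forall s, X s -> s i = b).
Proof. by case: b. Qed.

Hypothesis N_gt0 : 0 < size N.

Lemma sat_Theta (Z : {set pow2 N}) (X : team) :
  sat X (Theta Z) <-> trace X \subset Z.
Proof.
(* Each disjunct is then a genuine conjunction of literals, not the default [Bot]. *)
have enumN0 : enum {: seq_sub N} != [::].
  have N0 : nth 0 N 0 \in N by apply: mem_nth.
  apply/eqP=> enum0; have := mem_enum {: seq_sub N} (SeqSub N0).
  by rewrite enum0 in_nil.
have satT : sat X (Theta Z) <->
    (forall v, X v -> exists2 f, f \in enum Z & restr v = f).
  apply: (@sat_bigTensor_flat _ _ (fun f v => restr v = f)) => f A _.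
  apply: (iff_trans (sat_foldr1_And _ _ enumN0)); split=> [satA v Av|eqf i _].
    apply/ffunP=> i; rewrite ffunE.
    by have /sat_lit := satA i (mem_enum _ i); apply.
  by apply/sat_lit=> v /eqf <-; rewrite ffunE.
apply: (iff_trans satT); apply: iff_trans (iff_sym (trace_subP X Z)).
split=> XZ v /XZ; first by case=> f; rewrite mem_enum => fZ ->.
by exists (restr v); rewrite ?mem_enum.
Qed.

Lemma sat_alpha1 (X : team) : sat X (alpha1 N) <-> #|trace X| <= 1.
Proof.
have N0 : N != [::] by case: (N) N_gt0.
apply: (iff_trans (sat_foldr1_And _ _ N0)).
split=> [satX|card_le1 i iN s t Xs Xt _].
  apply/card_le1_eqP=> _ _ /traceP[s Xs <-] /traceP[t Xt <-].
  by apply/restr_eqP=> i iN; apply: (satX i iN).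
have /card_le1_eqP eq_trace := card_le1.
by have /restr_eqP := eq_trace _ _ (mem_trace Xt) (mem_trace Xs); apply.
Qed.

(** Each copy of [alpha1] covers at most one point of the trace; conversely, points are peeled off
    one per copy. *)
Lemma sat_alpha m (X : team) : sat X (alpha N m) <-> #|trace X| <= m.
Proof.
(* [iterop] appends no [Bot] at the end, so a tensor first appears with two copies, and 0 and 1 are
   separate base cases. *)
elim: m X => [|[|m] IHm] X; [|exact: sat_alpha1|].
  rewrite leqn0 cards_eq0 -subset0; split=> [/= ->|/trace_subP no].
    by apply/trace_subP.
  by apply/seteqP; split=> s // /no; rewrite inE.
split=> [[A [B [_ _ -> /sat_alpha1 cardA /IHm cardB]]]|cardX].
  rewrite trace_setU; apply: leq_trans (leq_card_setU _ _) _.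
  by rewrite -(add1n m.+1) leq_add.
have [X0|[f fX]] := set_0Vmem (trace X).
  exists X, X; split=> //; first by rewrite classical_sets.setUid.
    by apply/sat_alpha1; rewrite X0 cards0.
  by apply/IHm; rewrite X0 cards0.
exists (fun s => X s /\ restr s = f), (fun s => X s /\ restr s <> f).
split; [by move=> s [] | by move=> s [] | | | ].
- apply/seteqP; split=> [s Xs|s [[]|[]] //].
  by have [?|?] := pselect (restr s = f); [left|right].
- apply/sat_alpha1; rewrite -(cards1 f); apply: subset_leq_card.
  by apply/trace_subP=> s [_ ->]; rewrite inE.
apply/IHm; move: cardX; rewrite (cardsD1 f) fX add1n ltnS; apply: leq_trans.
apply: subset_leq_card; apply/trace_subP=> s [Xs sf].
by rewrite in_setD1 mem_trace // andbT; apply/eqP.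
Qed.

(** The [Theta] side avoids [Y], so a trace containing [Y] would force all its [k.+1] points into
    the [alpha] side, which holds at most [k]. Conversely, if [f] in [Y] is missed, the valuations
    restricting into [Y] have trace within [Y] minus [f], of size [k]. *)
Lemma sat_alpha_Theta k (Y : {set pow2 N}) (X : team) : #|Y| = k.+1 ->
  sat X (Tensor (alpha N k) (Theta (~: Y))) <-> ~~ (Y \subset trace X).
Proof.
move=> cardY; split=> [[A [B [_ _ -> /sat_alpha cardA /sat_Theta BY]]]|].
  apply: contraL cardA; rewrite trace_setU -ltnNge -cardY => /subsetP YAB.
  apply: subset_leq_card; apply/subsetP=> f fY.
  have := YAB f fY; rewrite in_setU => /orP[//|/(subsetP BY)].
  by rewrite inE fY.
case/subsetPn=> f fY fX.
exists (fun s => X s /\ restr s \in Y), (fun s => X s /\ restr s \notin Y).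
split; [by move=> s [] | by move=> s [] | | | ].
- apply/seteqP; split=> [s Xs|s [[]|[]] //].
  by have [?|?] := boolP (restr s \in Y); [left|right].
- apply/sat_alpha; move: cardY; rewrite (cardsD1 f) fY add1n => -[<-].
  apply: subset_leq_card; apply/trace_subP=> s [Xs sY].
  by rewrite in_setD1 sY andbT; apply: contraNneq fX => <-; apply: mem_trace.
- by apply/sat_Theta/trace_subP=> s [_]; rewrite inE.
Qed.

End Trace.

Theorem mainTheorem3 (phi : form) (N : seq nat) (N_gt0 : 0 < size N)
    (N_uniq : uniq N) (phiN : {subset vars phi <= N}) :
  exists (G : finType) (k : G -> nat) (Y : G -> {set pow2 N}),
    (forall g, Y g != set0 /\ #|Y g| = (k g).+1) /\
    sem_equiv (Some phi)
      (bigAnd [seq Tensor (alpha N (k g)) (Theta (~: Y g)) | g : G]).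
Proof.
pose falsifies (Y : {set pow2 N}) := ~~ `[< sat (cylinder Y) phi >].
pose G : finType := {Y : {set pow2 N} | falsifies Y}.
have Yn0 (g : G) : val g != set0.
  apply: contraNneq (valP g) => ->; apply/asboolP.
  suff -> : cylinder (set0 : {set pow2 N}) = classical_sets.set0.
    exact: sat_set0.
  by apply/seteqP; split=> s; rewrite /cylinder ?inE.
have cardY (g : G) : #|val g| = #|val g|.-1.+1 by rewrite prednK // card_gt0.
exists G, (fun g : G => #|val g|.-1), (fun g : G => val g).
split=> [g|X]; first exact: conj (Yn0 g) (cardY g).
split=> [satX|/osat_bigAnd satX].
  (* If the trace of [X] contained the falsifying team, [phi] would pass down from [X] to its
     cylinder. *)
  apply/osat_bigAnd=> g _; apply/sat_alpha_Theta => //.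
  apply: contra (valP g) => YX; apply/asboolP.
  by apply: (sat_trace phiN _ satX); rewrite trace_cylinder.
have [|falsX] := boolP `[< sat (cylinder (trace N X)) phi >].
  by move/asboolP; apply: (sat_trace phiN); rewrite trace_cylinder.
(* If [phi] failed on the trace of [X], that trace would itself be an index, and its conjunct would
   say that the trace does not contain itself. *)
pose g : G := Sub (trace N X) falsX.
have /(sat_alpha_Theta N_gt0) := satX g (mem_enum _ g).
by rewrite subxx => /(_ (cardY g)).
Qed.
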